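(* Let $D\subset\mathbb{R}^N$ be a linear subspace of dimension $p$ with orthogonal projection $P_D$, and let $\Phi,E:\mathbb{R}^N\times\mathbb{R}\to\mathbb{R}^N$ be differentiable maps with $\Phi(u;\lambda)=P_D\Phi(P_Du;\lambda)+E(u;\lambda)$ for all $(u,\lambda)$. Let $F(u,\lambda)=u-\Phi(u;\lambda)$, let $\dot u,u_0\in\mathbb{R}^N$ and $\dot\lambda,\lambda_0,s,s_0\in\mathbb{R}$ be fixed, and let $$G(u,\lambda)=\begin{pmatrix}F(u,\lambda)\\ \dot u^T(u-u_0)+\dot\lambda(\lambda-\lambda_0)-(s-s_0)\end{pmatrix}\in\mathbb{R}^{N+1}.$$ Then at every $(u,\lambda)$ the Jacobian of $G$ with respect to $(u,\lambda)$ is $G_{u,\lambda}=I_{N+1}-\mathcal{K}+\mathcal{E}$, where $$\mathcal{K}=\begin{pmatrix}P_D\Phi_u(P_Du;\lambda)P_D & P_D\Phi_\lambda(P_Du;\lambda)\\ -\dot u^T & 1-\dot\lambda\end{pmatrix},\qquad \mathcal{E}=\begin{pmatrix}-E_u(u;\lambda) & -E_\lambda(u;\lambda)\\ 0&0\end{pmatrix}.$$ Moreover, if $$\mathcal{D}=\mathrm{span}\left(\left\{\begin{pmatrix}d\\0\end{pmatrix}:d\in D\right\}\cup\left\{\begin{pmatrix}\dot u\\0\end{pmatrix},\begin{pmatrix}0\\1\end{pmatrix}\right\}\right)\subset\mathbb{R}^{N+1}$$ and $P_{\mathcal{D}}$ is the orthogonal projection of $\mathbb{R}^{N+1}$ onto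 $\mathcal{D}$, then $\mathcal{K}=P_{\mathcal{D}}\mathcal{K}P_{\mathcal{D}}$ and $\dim\mathcal{D}\le p+2$.
   Context: Subscripts $u$ and $\lambda$ denote partial derivatives (Jacobians) with respect to the vector variable $u\in\mathbb{R}^N$ and the scalar parameter $\lambda\in\mathbb{R}$. $I_{N+1}$ is the identity matrix on $\mathbb{R}^{N+1}$. Orthogonality is with respect to the usual Euclidean inner product. $\Phi$ is the output of a time-stepper, and $G$ is the augmented map of pseudo-arclength continuation, in which $\dot u$ and $\dot\lambda$ are fixed approximations of $du/ds$ and $d\lambda/ds$. *)

(* Defs.v *)
From HB Require Import structures.
From mathcomp Require Export all_boot all_order all_algebra.
From mathcomp Require Export all_classical all_reals all_analysis.
Export Order.TTheory GRing.Theory Num.Theory.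
Export numFieldNormedType.Exports.
Set Implicit Arguments.
Unset Strict Implicit.
Unset Printing Implicit Defensive.

Local Open Scope classical_set_scope.
Local Open Scope ring_scope.

(* The domain R^N x R of the maps below is 'cV[R]_N * R^o: the regular module
   R^o is R seen as a normed space over itself. *)

(* Matrix, acting on columns by left multiplication, of a linear map. *)
Definition col_matrix (R : realType) (m n : nat) (g : 'cV[R]_n -> 'cV[R]_m) :
    'M[R]_(m, n) :=
  \matrix_(i < m, j < n) g (delta_mx j 0) i 0.

(* Transpose of what the library's 'J would give: 'J is for
   maps between row vectors and acts by right multiplication. *)
Definition jacobian_u (R : realType) (N m : nat)
    (f : 'cV[R]_N * R^o -> 'cV[R]_m) (u : 'cV[R]_N) (l : R) : 'M[R]_(m, N) :=
  col_matrix ('d (fun v : 'cV[R]_N => f (v, l)) u).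

Definition partial_lambda (R : realType) (N m : nat)
    (f : 'cV[R]_N * R^o -> 'cV[R]_m) (u : 'cV[R]_N) (l : R) : 'cV[R]_m :=
  derive1 (fun k : R^o => f (u, k)) l.

(* Jacobian with respect to the joint variable (u, lambda): an element h of
   R^(N+1) is read as the increment (usubmx h, dsubmx h 0 0) of R^N x R. *)
Definition jacobian_ul (R : realType) (N m : nat)
    (f : 'cV[R]_N * R^o -> 'cV[R]_m) (u : 'cV[R]_N) (l : R) :
    'M[R]_(m, N + 1) :=
  col_matrix (fun h : 'cV[R]_(N + 1) =>
    'd f (u, l : R^o) (usubmx h, dsubmx h 0 0 : R^o)).

Definition is_orthogonal_projection (R : realType) (n : nat)
    (U : {vspace 'cV[R]_n}) (P : 'M[R]_n) : Prop :=
  forall x : 'cV[R]_n,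
    P *m x \in U /\ forall y : 'cV[R]_n, y \in U -> (x - P *m x)^T *m y = 0.

Definition is_span (R : realType) (n : nat) (A : set 'cV[R]_n)
    (U : {vspace 'cV[R]_n}) : Prop :=
  A `<=` [set x | x \in U] /\
  forall V : {vspace 'cV[R]_n}, A `<=` [set x | x \in V] -> (U <= V)%VS.

(* Both predicates determine a unique object. *)

Lemma is_span_exists (R : realType) (n : nat) (A : set 'cV[R]_n) :
  exists U, is_span A U.
Proof.
pose Q k := `[< exists s : seq 'cV[R]_n,
  [set x | x \in s] `<=` A /\ \dim (span s) = k >].
have Q0 : exists k, Q k.
  by exists 0%N; apply/asboolP; exists [::]; split=> //; rewrite span_nil dimv0.
have Qle k : Q k -> (k <= \dim {: 'cV[R]_n})%N.
  by move=> /asboolP[s [_ <-]]; exact/dimvS/subvf.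
have [k /asboolP[s [sA ks]] kmax] := ex_maxnP Q0 Qle.
exists (span s); split=> [x Ax /=|V AV]; last first.
  by apply/span_subvP => x /sA /AV.
have : Q (\dim (span (x :: s))).
  apply/asboolP; exists (x :: s); split=> // y /=.
  by rewrite inE => /orP[/eqP->//|/sA].
move=> /kmax; rewrite -ks => le_dim.
have sub : (span s <= span (x :: s))%VS by rewrite span_cons addvSr.
have /eqP -> : span s == span (x :: s) by rewrite eqEdim sub.
by rewrite memv_span// mem_head.
Qed.

Lemma is_span_unique (R : realType) (n : nat) (A : set 'cV[R]_n)
    (U V : {vspace 'cV[R]_n}) :
  is_span A U -> is_span A V -> U = V.
Proof.
move=> [AU minU] [AV minV]; apply/eqP.
by rewrite eqEsubv minU// minV.
Qed.

Lemma dotmx_eq0 (R : realType) (n : nat) (x : 'cV[R]_n) :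
  x^T *m x = 0 -> x = 0.
Proof.
move=> /matrixP /(_ 0 0); rewrite !mxE.
under eq_bigr do rewrite mxE -expr2.
move=> /eqP; rewrite psumr_eq0 => [/allP x0|i _]; last exact: sqr_ge0.
apply/matrixP => i j; rewrite (ord1 j) mxE; apply/eqP.
by rewrite -sqrf_eq0; apply: x0; rewrite mem_index_enum.
Qed.

Lemma is_orthogonal_projection_exists (R : realType) (n : nat)
    (U : {vspace 'cV[R]_n}) : exists P, is_orthogonal_projection U P.
Proof.
pose B : 'M[R]_(n, \dim U) := \matrix_(i, j) (vbasis U)`_j i 0.
have BE (c : 'cV[R]_(\dim U)) : B *m c = \sum_j c j 0 *: (vbasis U)`_j.
  apply/matrixP => i j; rewrite (ord1 j) mxE summxE.
  by apply: eq_bigr => k _; rewrite !mxE mulrC.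
have BU c : B *m c \in U.
  rewrite BE; apply: memv_suml => j _; apply/memvZ/vbasis_mem/mem_nth.
  by rewrite size_tuple.
have UB y : y \in U -> exists c, y = B *m c.
  move=> yU; exists (\col_j coord (vbasis U) j y).
  rewrite BE [LHS](coord_vbasis yU); apply: eq_bigr => j _.
  by rewrite mxE.
have B0 (c : 'cV_(\dim U)) : B *m c = 0 -> c = 0.
  rewrite BE => c0; apply/matrixP => j k; rewrite (ord1 k) mxE.
  have /freeP := basis_free (vbasisP U).
  by move=> /(_ (fun j => c j 0)) /(_ c0).
have uB : B^T *m B \in unitmx.
  rewrite -unitmx_tr -row_free_unit -kermx_eq0; apply/eqP/row_matrixP => i.
  rewrite row0; set w := row i _.
  have : w *m (B^T *m B)^T = 0 by apply/sub_kermxP/row_sub.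
  move=> /(congr1 trmx); rewrite trmx_mul trmxK trmx0 => w0.
  apply: trmx_inj; rewrite trmx0; apply/B0/dotmx_eq0.
  by rewrite trmx_mul -mulmxA [B^T *m _]mulmxA w0 mulmx0.
exists (B *m invmx (B^T *m B) *m B^T) => x; split.
  by rewrite -!mulmxA; exact: BU.
move=> _ /UB[c ->]; rewrite mulmxA.
have BT0 : B^T *m (x - B *m invmx (B^T *m B) *m B^T *m x) = 0.
  by rewrite mulmxBr !mulmxA (mulmxV uB) mul1mx subrr.
have -> : (x - B *m invmx (B^T *m B) *m B^T *m x)^T *m B = 0.
  by apply: trmx_inj; rewrite trmx_mul trmxK BT0 !trmx0.
by rewrite mul0mx.
Qed.

Lemma is_orthogonal_projection_unique (R : realType) (n : nat)
    (U : {vspace 'cV[R]_n}) (P Q : 'M[R]_n) :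
  is_orthogonal_projection U P -> is_orthogonal_projection U Q -> P = Q.
Proof.
move=> hP hQ.
suff PQ (x : 'cV_n) : P *m x = Q *m x.
  apply/matrixP => i j; have := PQ (delta_mx j 0).
  by rewrite -!colE => /matrixP /(_ i 0); rewrite !mxE.
have [PU Po] := hP x; have [QU Qo] := hQ x.
have dU : P *m x - Q *m x \in U by rewrite memvB.
apply/eqP; rewrite -subr_eq0; apply/eqP/dotmx_eq0.
have {1}-> : P *m x - Q *m x = (x - Q *m x) - (x - P *m x).
  by rewrite opprB [RHS]addrC addrA subrK.
by rewrite [(_ - _)^T]linearB mulmxBl Qo// Po// subrr.
Qed.

(* Main.v *)
(* G is a linear image of z, Phi (PD u, l) and E z plus a constant, so the
   chain rule gives its differential, and splitting 'd Phi and 'd E into partial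
   derivatives yields the block matrix.  The columns of K lie in calD because
   those of PD lie in D and (0, 1) is in calD; the columns of K^T lie in calD
   because PD^T = PD and (udot, 0), (0, 1) are in calD.  Hence P K = K and, by
   transposition, K P = K. *)
Require Import Defs.

Set Implicit Arguments.
Unset Strict Implicit.
Unset Printing Implicit Defensive.
Local Open Scope classical_set_scope.
Local Open Scope ring_scope.

Lemma is_diff_linear (R : realType) (V W : normedModType R)
    (f : {linear V -> W}) (x : V) : continuous f -> is_diff x f f.
Proof.
by move=> cf; apply: DiffDef; [exact: linear_differentiable|exact: diff_lin].
Qed.

Lemma is_diff_fst (R : realType) (V W : normedModType R)
    (z : V * W) : is_diff z fst fst.
Proof. by apply: is_diff_linear => x; exact: cvg_fst. Qed.

Lemma is_diff_snd (R : realType) (V W : normedModType R)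
    (z : V * W) : is_diff z snd snd.
Proof. by apply: is_diff_linear => x; exact: cvg_snd. Qed.

Lemma is_diff_mulmx (R : realType) (m n : nat) (A : 'M[R]_(m, n))
    (x : 'cV[R]_n) : is_diff x (mulmx A) (mulmx A).
Proof.
apply: is_diff_linear => y; apply: differentiable_continuous.
(* Continuity is read off from the expansion of [A *m v] as the sum of the columns of [A] weighted
   by the coordinates of [v], which are differentiable. *)
rewrite [X in differentiable X _](_ : _ =
  \sum_(j < n) (fun v : 'cV[R]_n => v j 0 *: col j A)); last first.
  apply/funext => v; rewrite fct_sumE; apply/matrixP => i k.
  rewrite (ord1 k) mxE summxE.
  by apply: eq_bigr => j _; rewrite !mxE mulrC.
by apply: differentiable_sum => j; apply/differentiableZl/differentiable_coord.
Qed.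

Lemma mulmx_col_matrix (R : realType) (m n : nat)
    (g : {linear 'cV[R]_n -> 'cV[R]_m}) (h : 'cV[R]_n) :
  col_matrix g *m h = g h.
Proof.
rewrite [in RHS](matrix_sum_delta h) linear_sum.
apply/matrixP => i k; rewrite (ord1 k) mxE summxE; apply: eq_bigr => j _.
by rewrite big_ord1 linearZ !mxE mulrC.
Qed.

Lemma col_matrix_mulmx (R : realType) (m n : nat) (A : 'M[R]_(m, n)) :
  col_matrix (mulmx A) = A.
Proof. by apply/matrixP => i j; rewrite mxE -colE mxE. Qed.

(** By the chain rule, freezing one variable restricts the total differential to increments [(w, 0)]
    or [(0, w)]; then [(h, k) = (h, 0) + k *: (0, 1)] and linearity conclude. *)
Lemma diff_partials (R : realType) (N m : nat)
    (f : 'cV[R]_N * R^o -> 'cV[R]_m) (v h : 'cV[R]_N) (l k : R) :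
  differentiable f (v, l : R^o) ->
  'd f (v, l : R^o) (h, k : R^o) =
    jacobian_u f v l *m h + k *: partial_lambda f v l.
Proof.
move=> df.
have du : is_diff v (fun w : 'cV[R]_N => f (w, l))
    (fun w => 'd f (v, l : R^o) (w, 0 : R^o)).
  apply: (@is_diff_comp _ _ _ _ (fun w : 'cV[R]_N => (w, l : R^o))
    (fun w : 'cV[R]_N => (w, 0 : R^o))); last exact: differentiableP.
have dl : is_diff (l : R^o) (fun w : R^o => f (v, w))
    (fun w => 'd f (v, l : R^o) (0, w)).
  apply: (@is_diff_comp _ _ _ _ (fun w : R^o => (v, w))
    (fun w : R^o => (0 : 'cV[R]_N, w))); last exact: differentiableP.
rewrite /jacobian_u mulmx_col_matrix (@diff_val _ _ _ _ _ _ _ du).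
rewrite /partial_lambda derive1E'; last exact: ex_diff.
rewrite (@diff_val _ _ _ _ _ _ _ dl) -linearZ -linearD; congr ('d f _ _).
by apply: injective_projections => /=;
  rewrite ?scaler0 ?addr0// add0r [RHS]mulr1.
Qed.

Lemma mulmx_colP (R : realType) (m n : nat) (A B : 'M[R]_(m, n)) :
  (forall h : 'cV[R]_n, A *m h = B *m h) -> A = B.
Proof.
move=> AB; apply/matrixP => i j; have := AB (delta_mx j 0).
by rewrite -!colE => /matrixP /(_ i 0); rewrite !mxE.
Qed.

Section OrthogonalProjection.
Context (R : realType) (n : nat) (U : {vspace 'cV[R]_n}) (P : 'M[R]_n).
Hypothesis hP : is_orthogonal_projection U P.

(** The residual [x - P *m x] lies in [U] and is orthogonal to [U], hence to itself. *)
Lemma orthogonal_projection_id (x : 'cV[R]_n) : x \in U -> P *m x = x.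
Proof.
move=> xU; have [PU Po] := hP x; apply/esym/eqP; rewrite -subr_eq0.
by apply/eqP/dotmx_eq0/Po; rewrite memvB.
Qed.

(** Residuals are orthogonal to the range of [P], so [P^T *m P = P^T]; the left-hand side is
    symmetric. *)
Lemma orthogonal_projection_sym : P^T = P.
Proof.
have PTP : P^T *m P = P^T.
  apply: mulmx_colP => y; rewrite -mulmxA; apply/eqP; rewrite -subr_eq0.
  (* With [w = P *m y - y], the squared norm of [P^T *m w] is the inner product of [w] with
     [P *m (P^T *m w)], an element of [U]. *)
  rewrite -mulmxBr; apply/eqP/dotmx_eq0.
  rewrite trmx_mul trmxK -mulmxA -[P *m y - y]opprB linearN mulNmx.
  by rewrite (proj2 (hP y)) ?oppr0//; exact: (proj1 (hP _)).
by rewrite -[LHS]PTP -[in RHS](trmxK P) -[in RHS]PTP trmx_mul trmxK.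
Qed.

Lemma orthogonal_projection_mull (m : nat) (A : 'M[R]_(n, m)) :
  (forall h : 'cV[R]_m, A *m h \in U) -> P *m A = A.
Proof.
move=> AU; apply: mulmx_colP => h.
by rewrite -mulmxA orthogonal_projection_id.
Qed.

Lemma orthogonal_projection_mulr (m : nat) (A : 'M[R]_(m, n)) :
  (forall h : 'cV[R]_m, A^T *m h \in U) -> A *m P = A.
Proof.
move=> AU; apply: trmx_inj.
by rewrite trmx_mul orthogonal_projection_sym orthogonal_projection_mull.
Qed.

End OrthogonalProjection.

Section AugmentedSpace.
Context (R : realType) (N p : nat) (D : {vspace 'cV[R]_N}) (PD : 'M[R]_N).
Hypotheses (dimD : \dim D = p) (hPD : is_orthogonal_projection D PD).
Context (udot : 'cV[R]_N) (calD : {vspace 'cV[R]_(N + 1)}).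
Hypothesis spanD : is_span
  ([set x | exists2 d : 'cV[R]_N, d \in D & x = col_mx d 0] `|`
   [set col_mx udot 0; col_mx 0 1%:M]) calD.

(** Both [K *m h] and [K^T *m h] have this shape, with [a = 0] for the former. *)
Lemma augmented_space_mem (d : 'cV[R]_N) (a : R) (b : 'cV[R]_1) :
  d \in D -> col_mx (d + a *: udot) b \in calD.
Proof.
move=> dD; have [inD _] := spanD.
have d0 : col_mx d (0 : 'cV[R]_1) \in calD by apply: inD; left; exists d.
have u0 : col_mx udot (0 : 'cV[R]_1) \in calD by apply: inD; right; left.
have e0 : col_mx (0 : 'cV[R]_N) 1%:M \in calD by apply: inD; right; right.
have -> : col_mx (d + a *: udot) b =
    col_mx d 0 + a *: col_mx udot 0 + b 0 0 *: col_mx 0 1%:M.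
  rewrite !scale_col_mx !add_col_mx !scaler0 !addr0 add0r; congr col_mx.
  by rewrite [b in LHS]mx11_scalar scalemx1.
by rewrite memvD ?memvZ// memvD ?memvZ.
Qed.

(** Minimality of the span puts [calD] inside the sum of the embedded copy of [D] and two lines, and
    dimension is subadditive. *)
Lemma augmented_dim : (\dim calD <= p + 2)%N.
Proof.
have [_ minD] := spanD.
pose L := linfun (mulmx (col_mx 1%:M 0 : 'M[R]_(N + 1, N))
  : 'cV[R]_N -> 'cV[R]_(N + 1)).
have LE d : L d = col_mx d 0 by rewrite lfunE /= mul_col_mx mul1mx mul0mx.
pose V := (L @: D + (<[col_mx udot (0 : 'cV[R]_1)]> +
  <[col_mx (0 : 'cV[R]_N) (1%:M : 'cV[R]_1)]>))%VS.
have /dimvS/leq_trans -> // : (calD <= V)%VS.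
  apply: minD => x /= [[d dD ->]|[->|->]].
  - by rewrite -LE (subvP (addvSl _ _))// memv_img.
  - by rewrite (subvP (addvSr _ _))// (subvP (addvSl _ _))// memv_line.
  - by rewrite (subvP (addvSr _ _))// (subvP (addvSr _ _))// memv_line.
apply: leq_trans (dimv_add_leqif _ _) _; apply: leq_add.
  by rewrite -dimD -(limg_ker_dim L D) leq_addl.
apply: leq_trans (dimv_add_leqif _ _) _; rewrite !dim_vline.
(* A line has dimension 1 or 0 according to whether its generator is nonzero; [udot] may vanish. *)
by do 2!case: (_ != 0).
Qed.

Lemma augmented_projection (P : 'M[R]_(N + 1)) (A : 'M[R]_N) (b : 'cV[R]_N)
    (c : 'M[R]_1) :
  is_orthogonal_projection calD P ->
  let K := block_mx (PD *m A *m PD) (PD *m b) (- udot^T) c : 'M[R]_(N + 1) in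
  K = P *m K *m P.
Proof.
move=> hP K.
have PDD v : PD *m v \in D by have [] := hPD v.
have -> : P *m K = K.
  apply: (orthogonal_projection_mull hP) => h.
  rewrite -[h]vsubmxK mul_block_col -!mulmxA -mulmxDr.
  by rewrite -[PD *m _]addr0 -(scale0r udot) augmented_space_mem.
apply/esym/(orthogonal_projection_mulr hP) => h.
rewrite -[h]vsubmxK tr_block_mx mul_block_col !trmx_mul linearN /= trmxK.
(* Symmetry of [PD] puts it back in front, so the upper block of [K^T *m h] is an element of [D]
   minus a multiple of [udot]. *)
rewrite (orthogonal_projection_sym hPD) -!mulmxA.
rewrite [X in - udot *m X]mx11_scalar mul_mx_scalar scalerN -scaleNr.
by rewrite augmented_space_mem.
Qed.

End AugmentedSpace.

Lemma bordered_mulmxE (R : realType) (N : nat) (P J JE : 'M[R]_N)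
    (b bE udot : 'cV[R]_N) (ldot : R) (h : 'cV[R]_(N + 1)) :
  let x := usubmx h in let k := dsubmx h 0 0 in
  (1%:M - block_mx (P *m J *m P) (P *m b) (- udot^T) (1 - ldot)%:M
     + block_mx (- JE) (- bE) 0 0) *m h =
  col_mx (x - P *m (J *m (P *m x) + k *: b) - (JE *m x + k *: bE))
         (udot^T *m x + (ldot * k)%:M).
Proof.
move=> x k; rewrite -[h]vsubmxK -/x.
have -> : dsubmx h = k%:M by exact: mx11_scalar.
rewrite scalar_mx_block opp_block_mx !add_block_mx mul_block_col; congr col_mx.
  rewrite !mulmxDl !mulNmx !mul0mx !add0r mul1mx -!mulmxA !mul_mx_scalar.
  rewrite mulmxDr -!scalemxAr !opprD.
  by rewrite !addrA; congr (_ - _); rewrite addrAC.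
(* In the last row, the 1 of the identity cancels the 1 of [1 - ldot]. *)
by rewrite !addr0 sub0r opprK -raddfB /= opprB addrCA subrr addr0 -scalar_mxM.
Qed.

Theorem mainTheorem2 (R : realType) (N p : nat)
    (D : {vspace 'cV[R]_N}) (dimD : \dim D = p)
    (PD : 'M[R]_N) (hPD : is_orthogonal_projection D PD)
    (Phi E : 'cV[R]_N * R^o -> 'cV[R]_N)
    (dPhi : forall z : 'cV[R]_N * R^o, differentiable Phi z)
    (dE : forall z : 'cV[R]_N * R^o, differentiable E z)
    (hPhi : forall (u : 'cV[R]_N) (l : R),
       Phi (u, l) = PD *m Phi (PD *m u, l) + E (u, l))
    (udot u0 : 'cV[R]_N) (ldot l0 s s0 : R) :
  let F := fun z : 'cV[R]_N * R^o => z.1 - Phi z in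
  let G := fun z : 'cV[R]_N * R^o =>
    col_mx (F z)
           (udot^T *m (z.1 - u0) + (ldot * (z.2 - l0) - (s - s0))%:M)
      : 'cV[R]_(N + 1) in
  let calK := fun (u : 'cV[R]_N) (l : R) =>
    block_mx (PD *m jacobian_u Phi (PD *m u) l *m PD)
             (PD *m partial_lambda Phi (PD *m u) l)
             (- udot^T) (1 - ldot)%:M : 'M[R]_(N + 1) in
  let calE := fun (u : 'cV[R]_N) (l : R) =>
    block_mx (- jacobian_u E u l) (- partial_lambda E u l)
             0 0 : 'M[R]_(N + 1) in
  (forall (u : 'cV[R]_N) (l : R),
     differentiable G (u, l : R^o) /\
     jacobian_ul G u l = 1%:M - calK u l + calE u l) /\
  (forall calD : {vspace 'cV[R]_(N + 1)},
     is_span ([set x | exists2 d : 'cV[R]_N, d \in D & x = col_mx d 0] `|`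
              [set col_mx udot 0; col_mx 0 1%:M]) calD ->
     (forall PcalD : 'M[R]_(N + 1), is_orthogonal_projection calD PcalD ->
        forall (u : 'cV[R]_N) (l : R),
          calK u l = PcalD *m calK u l *m PcalD) /\
     (\dim calD <= p + 2)%N).
Proof.
move=> F G calK calE; split=> [u l|calD spanD]; last first.
  split=> [P hP u l|]; last exact: (augmented_dim dimD spanD).
  exact: (augmented_projection hPD spanD).
(* Placing a vector in the upper block or a scalar in the last entry becomes a linear map, so that
   [G] turns into a sum of compositions without [col_mx]. *)
pose inj : 'M[R]_(N + 1, N) := col_mx 1%:M 0.
pose bot : 'cV[R]_(N + 1) := col_mx 0 1%:M.
have injE (v : 'cV[R]_N) : inj *m v = col_mx v 0.
  by rewrite mul_col_mx mul1mx mul0mx.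
have botE (a : R) : a *: bot = col_mx 0 a%:M.
  by rewrite scale_col_mx scaler0 scalemx1.
have botuE (v : 'cV[R]_N) : bot *m udot^T *m v = col_mx 0 (udot^T *m v).
  by rewrite -mulmxA mul_col_mx mul0mx mul1mx.
(* The part of the last entry of [G] that is independent of [(u, lambda)]. *)
pose cstG : 'cV[R]_(N + 1) :=
  col_mx 0 (- (udot^T *m u0) - (ldot * l0 + (s - s0))%:M).
have GE : G = (mulmx inj \o fst) -
    (mulmx (inj *m PD) \o (Phi \o (fun z => (PD *m z.1, z.2)))) -
    (mulmx inj \o E) + (mulmx (bot *m udot^T) \o fst) +
    (ldot *: (( *:%R ^~ bot) \o snd)) + cst cstG.
  apply/funext => -[v k].
  rewrite /G /F !fctE /= hPhi -mulmxA !injE botE botuE !opp_col_mx.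
  rewrite scale_col_mx !add_col_mx; congr col_mx.
    by rewrite scaler0 !addr0 opprD addrA.
  rewrite !oppr0 !add0r scale_scalar_mx mulmxBr mulrBr -addrA -opprD.
  rewrite -[_ - _ - (s - s0)]addrA -opprD raddfB /= opprD !addrA.
  by congr (_ - _); rewrite addrAC.
have dPhi0 := differentiableP (dPhi (PD *m u, l : R^o)).
have dE0 := differentiableP (dE (u, l : R^o)).
set z0 := (u, l : R^o).
have d1 A : is_diff z0 (mulmx A \o fst : _ -> 'cV[R]_(N + 1)) (mulmx A \o fst).
  exact: (is_diff_comp (is_diff_fst z0) (is_diff_mulmx A _)).
have d2 : is_diff z0 (fun z => (PD *m z.1, z.2)) (fun z => (PD *m z.1, z.2)).
  exact: (is_diff_pair (is_diff_comp (is_diff_fst z0) (is_diff_mulmx PD _))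
           (is_diff_snd z0)).
have d3 := is_diff_comp (is_diff_comp d2 dPhi0) (is_diff_mulmx (inj *m PD) _).
have d4 := is_diff_comp dE0 (is_diff_mulmx inj _).
have d5 := is_diff_comp (is_diff_snd z0) (is_diff_scalel _ bot).
have d13 := is_diffB (d1 inj) d3.
have d134 := is_diffB d13 d4.
have dF := is_diffD d134 (d1 (bot *m udot^T)).
have dFl := is_diffD dF (is_diffZ ldot d5).
have dG := is_diffD dFl (is_diff_cst cstG z0).
rewrite -GE in dG.
split; first exact: (@ex_diff _ _ _ _ _ _ _ dG).
(* The matrix identity reduces to equality of the two linear maps on each increment [h]. *)
rewrite -[RHS]col_matrix_mulmx /jacobian_ul; congr col_matrix.
apply/funext => h; rewrite bordered_mulmxE.
set x := usubmx h; set k := dsubmx h 0 0.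
(* The inner map [(PD *m u, l)] is linear, so it sends the increment [(x, k)] to [(PD *m x, k)]. *)
rewrite -(diff_partials (PD *m x) k (dPhi (PD *m u, l))).
rewrite -(diff_partials x k (dE (u, l))).
rewrite (@diff_val _ _ _ _ _ _ _ dG) !fctE /comp.
(* The term removed is the differential of the constant [cstG]. *)
rewrite [X in _ + X = _](_ : _ = 0) // addr0.
rewrite -mulmxA !injE scalerA botE botuE !opp_col_mx !add_col_mx.
by rewrite !subr0 !addr0 add0r.
Qed.
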